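(* Let $n\ge 3$ be an integer and let $\Gamma=\mathrm{Cay}(G,S)$ be a connected inner-automorphic Cayley graph on a group $G\cong \mathrm{D}_{2n}$. Then: (i) $\Gamma$ is at most $3$-arc-transitive, i.e. it is not $s$-arc-transitive for any $s\ge 4$; (ii) $\Gamma$ is $3$-arc-transitive if and only if $\Gamma\cong \mathsf{K}_{n,n}$; (iii) $\Gamma$ is $2$-arc-transitive if and only if $\Gamma$ is isomorphic to $\mathsf{K}_{2n}$, to $\mathsf{K}_{n,n}$, or to $\mathsf{K}_{n,n}-n\mathsf{K}_2$ with $n\ge 4$.
   Context: All graphs are finite, simple and undirected. $\mathrm{D}_{2n}$ is the dihedral group of order $2n$. For a finite group $G$ and $S\subseteq G\setminus\{1\}$ with $S=S^{-1}$, $\mathrm{Cay}(G,S)$ is the graph with vertex set $G$ in which $x,y$ are adjacent iff $yx^{-1}\in S$; it is inner-automorphic if $S$ is a union of conjugacy classes of $G$. For $s\ge 1$, an $s$-arc of $\Gamma$ is a sequence $(u_0,\dots,u_s)$ of vertices with $u_i$ adjacent to $u_{i+1}$ for $0\le i\le s-1$ and $u_{j-1}\ne u_{j+1}$ for $1\le j\le s-1$. A graph $\Gamma$ is $s$-arc-transitive if $\mathrm{Aut}(\Gamma)$ is transitive on vertices and on the set of $s$-arcs of $\Gamma$. $\mathsf{K}_{2n}$ is the complete graph on $2n$ vertices, $\mathsf{K}_{n,n}$ the complete bipartite graph with parts of size $n$, and $\mathsf{K}_{n,n}-n\mathsf{K}_2$ is $\mathsf{K}_{n,n}$ minus a perfect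 matching. *)

(* Defs.v *)
From mathcomp Require Import all_boot all_fingroup all_solvable.

Set Implicit Arguments.
Unset Strict Implicit.
Unset Printing Implicit Defensive.

Local Open Scope group_scope.

(* A graph is given by its adjacency relation on a finite vertex type; all the
   relations defined below are symmetric and irreflexive ([cay S] when
   [1 \notin S] and [S^-1 = S]). *)

Section Graphs.

Variable T : finType.
Implicit Type e : rel T.

Definition connected_graph e := forall x y, connect e x y.

Definition graph_aut e : {set {perm T}} :=
  [set f : {perm T} | [forall x, forall y, e (f x) (f y) == e x y]].

Lemma graph_aut_group_set e : group_set (graph_aut e).
Proof.
apply/group_setP; split.
  by rewrite inE; apply/forallP => x; apply/forallP => y; rewrite !perm1.
move=> f g; rewrite !inE => /forallP ef /forallP eg.
apply/forallP => x; apply/forallP => y.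
by rewrite !permM (eqP (forallP (eg _) _)) (eqP (forallP (ef _) _)).
Qed.

Canonical graph_aut_group e := Group (graph_aut_group_set e).

(* In the second clause j stands for the usual j - 1, so that it runs over
   0 <= j < s - 1. *)
Definition sarcs e (s : nat) : {set s.+1.-tuple T} :=
  [set u : s.+1.-tuple T |
    [forall i : 'I_s, e (tnth u (inord i)) (tnth u (inord i.+1))]
    && [forall j : 'I_s.-1, tnth u (inord j) != tnth u (inord j.+2)]].

(* [transitive A, on X | to] also requires X to be nonempty; this is harmless
   for vertices and arcs of a connected graph on at least 3 vertices that is
   vertex-transitive, since such a graph has s-arcs for every s. *)
Definition arc_transitive e (s : nat) : bool :=
  [transitive graph_aut e, on [set: T] | 'P]
  && [transitive graph_aut e, on sarcs e s | 'P * s.+1].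

End Graphs.

Definition graph_iso (T U : finType) (e : rel T) (e' : rel U) : Prop :=
  exists2 f : T -> U, bijective f & forall x y, e' (f x) (f y) = e x y.

Definition complete_graph m : rel 'I_m := fun x y => x != y.

Definition complete_bipartite n : rel (bool * 'I_n) :=
  fun x y => x.1 != y.1.

(* The perfect matching removed is {(false, i), (true, i)}, i < n. *)
Definition complete_bipartite_minus_matching n : rel (bool * 'I_n) :=
  fun x y => (x.1 != y.1) && (x.2 != y.2).

Section Cayley.

Variable gT : finGroupType.
Implicit Type S : {set gT}.

Definition cay S : rel gT := fun x y => y * x^-1 \in S.

Definition union_of_classes S : Prop :=
  exists2 C : {set {set gT}}, C \subset classes [set: gT] & S = cover C.

End Cayley.

(* Main.v *)
Require Import Defs.
From mathcomp Require Import all_boot all_fingroup all_solvable.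
From mathcomp Require Import zify.

Set Implicit Arguments.
Unset Strict Implicit.
Unset Printing Implicit Defensive.

(** In each of the three families the automorphism group is large enough for
the claimed transitivity, while one more step is impossible because a longer
arc may or may not have equal or adjacent ends: triangles prevent
3-arc-transitivity of a complete graph, 4-cycles prevent 4-arc-transitivity of
[K_{n,n}], and the matched pairs prevent 3-arc-transitivity of [K_{n,n}] minus
a perfect matching. Since (s+1)-arc-transitivity implies s-arc-transitivity
([arc_transitive_pred]), everything follows once the 2-arc-transitive graphs
are known to be in these families.

So let [Cay(G, S)] be connected and 2-arc-transitive, with [S] normal in the
dihedral group [G] with rotation subgroup [A]. If the graph has a triangle, all
2-arcs close up and it is complete
([triangle_2arc_transitive_complete]). Suppose there is no triangle, that is,
no product of two elements of [S] lies in [S]. By connectedness [S] contains a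
reflection [b]. If it contains all of them, it contains no rotation, and [S] is
the complement of [A]. Otherwise it misses a reflection [c]; with [Q] the group
of squares of rotations, the conjugates of [b] fill [Q b] and those of [c] fill
[Q c], so that [K = Q u Q c] is a subgroup of index two and [S] lies outside
it. The graph is bipartite with parts [K] and its complement, each of size
[n = 2 |Q|]. Distinct vertices in [K] are all at distance two, so by
2-arc-transitivity every element of [K] other than the identity has the same
number [mu] of common neighbours with the identity. Evaluated at [c],
[mu = 2 r], where [r] is the number of rotations in [S]: one factor of a
factorization of [c] is a rotation and determines the other. Counting walks of
length two from the identity
([card_index2_constant_common_neighbours]) gives
[|S| (|S| - 1) = (n - 1) mu] with [|S| = |Q| + r], that is,
[(|Q| - r)^2 = |Q| - r]. Hence [S] is the complement of [K], or that complement
with one element removed; the Cayley graphs are then [K_{n,n}] and [K_{n,n}]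
minus a perfect matching. In the last case [n = 2 |Q|] is even, which rules out
[n = 3]. *)

(** * Arcs and arc-transitivity *)

(** Arcs as sequences, so that concrete short arcs can be checked by
computation. *)
Fixpoint nonbacktracking (T : eqType) (e : rel T) (p : seq T) : bool :=
  if p is x :: q then
    [&& (if q is y :: _ then e x y else true),
        (if q is _ :: z :: _ then x != z else true)
      & nonbacktracking e q]
  else true.

Lemma nonbacktrackingP (T : eqType) (e : rel T) (x0 : T) (p : seq T) :
  reflect ((forall i, i.+1 < size p -> e (nth x0 p i) (nth x0 p i.+1)) /\
           (forall i, i.+2 < size p -> nth x0 p i != nth x0 p i.+2))
          (nonbacktracking e p).
Proof.
elim: p => [|x p IHp]; first by left.
apply: (iffP and3P) => [[exy xz /IHp [ep np]] | [ep np]].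
  split=> [[|i]|[|i]] /=; [| exact: ep | | exact: np].
    by case: p exy {xz IHp ep np}.
  by case: p xz {exy IHp ep np} => [|y [|z p]].
split.
- by case: p ep {np IHp} => [//|y p] /(_ 0); apply.
- by case: p np {ep IHp} => [//|y [//|z p]] /(_ 0); apply.
- by apply/IHp; split=> i ip; [apply: (ep i.+1) | apply: (np i.+1)].
Qed.

Lemma mem_sarcs (T : finType) (e : rel T) s (u : s.+1.-tuple T) :
  (u \in sarcs e s) = nonbacktracking e u.
Proof.
have x0 : T := thead u.
rewrite inE; apply/andP/(nonbacktrackingP e x0); rewrite size_tuple.
  move=> [/forallP ep /forallP np]; split=> i lti.
    by have := ep (Ordinal (lti : i < s)); rewrite !(tnth_nth x0) /= !inordK //; lia.
  have lti1 : i < s.-1 by lia.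
  by have := np (Ordinal lti1); rewrite !(tnth_nth x0) /= !inordK //; lia.
move=> [ep np]; split; apply/forallP=> i.
  by rewrite !(tnth_nth x0) !inordK ?ep //; have := ltn_ord i; lia.
by rewrite !(tnth_nth x0) !inordK ?np //; have := ltn_ord i; lia.
Qed.

Lemma nonbacktracking_map (T U : eqType) (f : T -> U) (e : rel T) (e' : rel U) p :
  injective f -> (forall x y, e' (f x) (f y) = e x y) ->
  nonbacktracking e' (map f p) = nonbacktracking e p.
Proof.
move=> injf fe; elim: p => //= x p ->.
by case: p => [//|y [|z p]] /=; rewrite ?(inj_eq injf) ?fe.
Qed.

Lemma graph_autP (T : finType) (e : rel T) (f : {perm T}) :
  reflect (forall x y, e (f x) (f y) = e x y) (f \in graph_aut e).
Proof.
rewrite inE; apply: (iffP forallP) => [ef x y | ef x].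
  exact: (eqP (forallP (ef x) y)).
by apply/forallP=> y; rewrite ef.
Qed.

(** Both transitivity conditions in terms of functions: the group actions on
vertices and on tuples are unfolded once and for all here. *)
Lemma arc_transitiveP (T : finType) (e : rel T) s :
  arc_transitive e s <->
  [/\ exists u, u \in sarcs e s,
      forall x y, exists2 f, f \in graph_aut e & y = f x
    & forall u v, u \in sarcs e s -> v \in sarcs e s ->
        exists2 f : {perm T}, f \in graph_aut e & val v = map f u].
Proof.
split=> [/andP[trv tra] | [[u au] trv tra]].
  split=> [|x y|u v au av].
  - by case/imsetP: tra => u au _; exists u.
  - by case: (atransP2 trv (in_setT x) (in_setT y)) => f fe ->; exists f.
  - by case: (atransP2 tra au av) => f fe ->; exists f.
apply/andP; split; apply/imsetP.
  exists (thead u); rewrite ?inE //; apply/esym/setP=> y; rewrite inE.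
  by case: (trv (thead u) y) => f fe ->; apply/imsetP; exists f.
exists u => //; apply/setP=> v; apply/idP/imsetP => [av | [f fe ->]].
  by case: (tra u v au av) => f fe vE; exists f => //; apply: val_inj.
rewrite mem_sarcs /= (@nonbacktracking_map _ _ _ e) -?mem_sarcs //.
  exact: perm_inj.
exact/graph_autP.
Qed.

(** Dropping the last vertex of an arc is equivariant and, as soon as walks
can always be continued, every arc is obtained in this way. *)
Lemma arc_transitive_pred (T : finType) (e : rel T) s :
  (forall x y, exists2 z, e y z & x != z) ->
  arc_transitive e s.+1 -> arc_transitive e s.
Proof.
move=> ext /arc_transitiveP[[u au] trv tra].
have extend (v : s.+1.-tuple T) : v \in sarcs e s ->
    exists z, [tuple of rcons v z] \in sarcs e s.+1.
  pose x0 := thead v.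
  have [z ez nz] := ext (nth x0 v s.-1) (nth x0 v s).
  rewrite mem_sarcs => /(nonbacktrackingP e x0); rewrite size_tuple.
  move=> [ep np]; exists z; rewrite mem_sarcs; apply/(nonbacktrackingP e x0).
  rewrite /= size_rcons size_tuple; split=> i; rewrite !ltnS => lti.
    rewrite !nth_rcons size_tuple ltnS lti ltnS.
    move: lti; rewrite leq_eqVlt => /predU1P[->|lti]; first by rewrite ltnn eqxx.
    by rewrite lti ep.
  rewrite !nth_rcons size_tuple !ltnS (ltnW lti).
  move: lti; rewrite leq_eqVlt => /predU1P[iE|lti]; last by rewrite lti np.
  by rewrite iE ltnn eqxx; have -> : i = s.-1 by rewrite -iE.
apply/arc_transitiveP; split=> // [|v w av aw].
  have sz : size (take s.+1 u) == s.+1 by rewrite size_takel // size_tuple.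
  exists (Tuple sz); move: au; rewrite !mem_sarcs.
  move=> /(nonbacktrackingP e (thead u)); rewrite size_tuple => -[ep np].
  apply/(nonbacktrackingP e (thead u)); rewrite /= (eqP sz).
  by split=> i lti; rewrite !nth_take ?(ep, np) //; lia.
have [z /tra trz] := extend v av; have [t /trz] := extend w aw.
move=> [f fe]; rewrite /= map_rcons => /eqP; rewrite eqseq_rcons => /andP[/eqP wE _].
by exists f.
Qed.

(** Automorphisms preserve any relation between the two ends of an arc that is
expressed by adjacency or by equality. *)
Lemma arc_transitive_ends (T : finType) (e : rel T) s (u v : s.+1.-tuple T) x0 :
  arc_transitive e s -> nonbacktracking e u -> nonbacktracking e v ->
  (e (head x0 u) (last x0 u) = e (head x0 v) (last x0 v)) *
  ((head x0 u == last x0 u) = (head x0 v == last x0 v)).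
Proof.
move=> /arc_transitiveP[_ _ tra]; rewrite -!mem_sarcs => au /(tra _ _ au).
move=> [f /graph_autP fe ->]; case: u {au} => [[|x p] //= _].
by rewrite last_map fe (inj_eq perm_inj).
Qed.

(** * Graph isomorphisms *)

Lemma graph_iso_sym (T U : finType) (e : rel T) (e' : rel U) :
  graph_iso e e' -> graph_iso e' e.
Proof.
move=> [f [g fK gK] fe]; exists g; first by exists f.
by move=> x y; rewrite -{2}(gK x) -{2}(gK y) fe.
Qed.

Lemma arc_transitive_iso (T U : finType) (e : rel T) (e' : rel U) s :
  graph_iso e e' -> arc_transitive e s -> arc_transitive e' s.
Proof.
move=> [f [g fK gK] fe] /arc_transitiveP[[u au] trv tra].
have ge x y : e (g x) (g y) = e' x y by rewrite -fe !gK.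
have injf := can_inj fK; have injg := can_inj gK.
have conj (h : {perm T}) : h \in graph_aut e ->
    exists2 k, k \in graph_aut e' & k =1 f \o h \o g.
  move=> /graph_autP he.
  have injk : injective (f \o h \o g) by do !apply: inj_comp => //; apply: perm_inj.
  exists (perm injk); last by move=> x; rewrite permE.
  by apply/graph_autP=> x y; rewrite !permE /= fe he.
apply/arc_transitiveP; split.
- exists [tuple of map f u].
  by rewrite mem_sarcs /= (nonbacktracking_map _ injf fe) -mem_sarcs.
- move=> x y; have [h /conj[k ke kE] gy] := trv (g x) (g y).
  by exists k; rewrite // kE /= -gy gK.
move=> v w; rewrite !mem_sarcs.
rewrite -(nonbacktracking_map v injg ge) -(nonbacktracking_map w injg ge) => av aw.
have := tra [tuple of map g v] [tuple of map g w]; rewrite !mem_sarcs.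
move=> /(_ av aw)[h /conj[k ke kE] /= wE]; exists k => //.
have := congr1 (map f) wE; rewrite -!map_comp map_id_in => [->|x _ /=]; last exact: gK.
by apply: eq_map => x; rewrite kE.
Qed.

(** * The three families of graphs *)

(** Symmetric groups are transitive on lists of distinct points of any given
length; this supplies all the automorphisms used below. *)
Lemma perm_map_uniq (T : finType) (p q : seq T) :
  uniq p -> uniq q -> size p = size q -> exists f : {perm T}, map f p = q.
Proof.
move=> up uq /esym szq.
have szT : size p <= #|T| by rewrite -(card_uniqP up) max_card.
have := ntransitive_weak szT (Sym_trans T) => /atransP2.
have dt (t : (size p).-tuple T) : uniq t -> t \in (size p).-dtuple([set: T]).
  by move=> ut; rewrite inE ut; apply/subsetP=> z _; rewrite inE.
pose qt : (size p).-tuple T := Tuple (introT eqP szq).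
move=> /(_ _ qt (dt (in_tuple p) up) (dt qt uq))[f _ qE].
by exists f; rewrite -[RHS]/(val qt) qE.
Qed.

Lemma complete_graph_2arc_transitive m :
  3 <= m -> arc_transitive (@complete_graph m) 2.
Proof.
move=> le3m; have aut f : f \in graph_aut (@complete_graph m).
  by apply/graph_autP=> x y; rewrite /complete_graph (inj_eq perm_inj).
apply/arc_transitiveP; split=> [|x y|u v].
- case: m le3m {aut} => [|[|[|m]]] // _.
  exists [tuple Ordinal (isT : 0 < m.+3); Ordinal (isT : 1 < m.+3);
                Ordinal (isT : 2 < m.+3)].
  by rewrite mem_sarcs.
- have [f [<-]] := @perm_map_uniq _ [:: x] [:: y] isT isT erefl.
  by exists f.
suff uniq3 (w : 3.-tuple 'I_m) : w \in sarcs (@complete_graph m) 2 -> uniq w.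
  move=> /uniq3 uu /uniq3 uv.
  have [|f fE] := perm_map_uniq uu uv; first by rewrite !size_tuple.
  by exists f.
rewrite mem_sarcs; case: w => [[|a [|b [|c [|//]]]] //= _].
by rewrite /complete_graph !inE negb_or => /and4P[-> -> -> _].
Qed.

Lemma complete_graph_not_3arc_transitive m :
  4 <= m -> ~~ arc_transitive (@complete_graph m) 3.
Proof.
case: m => [|[|[|[|m]]]] // _; apply/negP.
pose i0 := Ordinal (isT : 0 < m.+4); pose i1 := Ordinal (isT : 1 < m.+4).
pose i2 := Ordinal (isT : 2 < m.+4); pose i3 := Ordinal (isT : 3 < m.+4).
(* a 3-arc may close up into a triangle or not *)
by move=> /(@arc_transitive_ends _ _ _ [tuple i0; i1; i2; i0]
             [tuple i0; i1; i2; i3] i0)/(_ isT isT)[].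
Qed.

(** Independent permutations of the two parts, followed by an optional swap of
the parts. *)
Lemma complete_bipartite_aut n (c : bool) (s : bool -> {perm 'I_n}) :
  exists2 f, f \in graph_aut (@complete_bipartite n)
           & forall x, f x = (x.1 (+) c, s x.1 x.2).
Proof.
have injf : injective (fun x : bool * 'I_n => (x.1 (+) c, s x.1 x.2)).
  by move=> [b i] [d j] [/addIb <- /perm_inj <-].
exists (perm injf); last by move=> x; rewrite permE.
apply/graph_autP=> x y; rewrite !permE /complete_bipartite /=.
by rewrite (inj_eq (@addIb c)).
Qed.

Lemma complete_bipartite_3arc_transitive n :
  2 <= n -> arc_transitive (@complete_bipartite n) 3.
Proof.
move=> le2n; apply/arc_transitiveP; split=> [|[b i] [d j]|u v].
- case: n le2n => [|[|n]] // _.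
  pose i0 := Ordinal (isT : 0 < n.+2); pose i1 := Ordinal (isT : 1 < n.+2).
  exists [tuple (false, i0); (true, i0); (false, i1); (true, i1)].
  by rewrite mem_sarcs.
- have [s [si]] := @perm_map_uniq _ [:: i] [:: j] isT isT erefl.
  have [f fe fE] := complete_bipartite_aut (b (+) d) (fun _ => s).
  by exists f; rewrite // fE /= si addKb.
rewrite !mem_sarcs.
case: u => [[|[b0 i0] [|[b1 i1] [|[b2 i2] [|[b3 i3] [|//]]]]] //= _].
case: v => [[|[d0 j0] [|[d1 j1] [|[d2 j2] [|[d3 j3] [|//]]]]] //= _].
rewrite /complete_bipartite !xpair_eqE /= !andbT.
move=> /and5P[b01 i02 b12 i13 b23] /and5P[d01 j02 d12 j13 d23].
have {b01} b1E : b1 = ~~ b0 by case: (b0) (b1) b01 => [] [].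
have {b12} b2E : b2 = b0 by case: (b0) (b1) (b2) b12 b1E => [] [] [].
have {b23} b3E : b3 = ~~ b0 by case: (b0) (b2) (b3) b23 b2E => [] [] [].
have {d01} d1E : d1 = ~~ d0 by case: (d0) (d1) d01 => [] [].
have {d12} d2E : d2 = d0 by case: (d0) (d1) (d2) d12 d1E => [] [] [].
have {d23} d3E : d3 = ~~ d0 by case: (d0) (d2) (d3) d23 d2E => [] [] [].
subst b1 b2 b3 d1 d2 d3; rewrite !eqxx /= in i02 i13 j02 j13.
have uniq2 (i j : 'I_n) : i != j -> uniq [:: i; j] by rewrite /= inE andbT.
have [s [s0 s2]] := perm_map_uniq (uniq2 _ _ i02) (uniq2 _ _ j02) erefl.
have [t [t1 t3]] := perm_map_uniq (uniq2 _ _ i13) (uniq2 _ _ j13) erefl.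
have [f fe fE] := complete_bipartite_aut (b0 (+) d0) (fun b => if b == b0 then s else t).
exists f; rewrite //= !fE /= eqxx addKb s0 s2.
have -> : (~~ b0 == b0) = false by case: (b0).
by rewrite t1 t3 addNb addKb.
Qed.

Lemma complete_bipartite_not_4arc_transitive n :
  3 <= n -> ~~ arc_transitive (@complete_bipartite n) 4.
Proof.
case: n => [|[|[|n]]] // _; apply/negP.
pose i0 := Ordinal (isT : 0 < n.+3); pose i1 := Ordinal (isT : 1 < n.+3).
pose i2 := Ordinal (isT : 2 < n.+3).
(* a 4-arc may close up into a 4-cycle or not *)
by move=> /(@arc_transitive_ends _ _ _
    [tuple (false, i0); (true, i0); (false, i1); (true, i1); (false, i0)]
    [tuple (false, i0); (true, i0); (false, i1); (true, i1); (false, i2)]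
    (false, i0))/(_ isT isT)[].
Qed.

Lemma complete_bipartite_minus_matching_aut n (c : bool) (s : {perm 'I_n}) :
  exists2 f, f \in graph_aut (@complete_bipartite_minus_matching n)
           & forall x, f x = (x.1 (+) c, s x.2).
Proof.
have injf : injective (fun x : bool * 'I_n => (x.1 (+) c, s x.2)).
  by move=> [b i] [d j] [/addIb <- /perm_inj <-].
exists (perm injf); last by move=> x; rewrite permE.
apply/graph_autP=> x y; rewrite !permE /complete_bipartite_minus_matching /=.
by rewrite (inj_eq (@addIb c)) (inj_eq perm_inj).
Qed.

Lemma complete_bipartite_minus_matching_2arc_transitive n :
  3 <= n -> arc_transitive (@complete_bipartite_minus_matching n) 2.
Proof.
move=> le3n; apply/arc_transitiveP; split=> [|[b i] [d j]|u v].
- case: n le3n => [|[|[|n]]] // _.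
  pose i0 := Ordinal (isT : 0 < n.+3); pose i1 := Ordinal (isT : 1 < n.+3).
  pose i2 := Ordinal (isT : 2 < n.+3).
  exists [tuple (false, i0); (true, i1); (false, i2)].
  by rewrite mem_sarcs.
- have [s [si]] := @perm_map_uniq _ [:: i] [:: j] isT isT erefl.
  have [f fe fE] := complete_bipartite_minus_matching_aut (b (+) d) s.
  by exists f; rewrite // fE /= si addKb.
rewrite !mem_sarcs.
case: u => [[|[b0 i0] [|[b1 i1] [|[b2 i2] [|//]]]] //= _].
case: v => [[|[d0 j0] [|[d1 j1] [|[d2 j2] [|//]]]] //= _].
rewrite /complete_bipartite_minus_matching !xpair_eqE /= !andbT.
move=> /and3P[/andP[b01 i01] i02 /andP[b12 i12]].
move=> /and3P[/andP[d01 j01] j02 /andP[d12 j12]].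
have {b01} b1E : b1 = ~~ b0 by case: (b0) (b1) b01 => [] [].
have {b12} b2E : b2 = b0 by case: (b0) (b1) (b2) b12 b1E => [] [] [].
have {d01} d1E : d1 = ~~ d0 by case: (d0) (d1) d01 => [] [].
have {d12} d2E : d2 = d0 by case: (d0) (d1) (d2) d12 d1E => [] [] [].
subst b1 b2 d1 d2; rewrite !eqxx /= in i02 j02.
have uniq3 (i j k : 'I_n) : i != j -> i != k -> j != k -> uniq [:: i; j; k].
  by rewrite /= !inE negb_or => -> -> ->.
have [s [s0 s1 s2]] := perm_map_uniq (uniq3 _ _ _ i01 i02 i12)
                                     (uniq3 _ _ _ j01 j02 j12) erefl.
have [f fe fE] := complete_bipartite_minus_matching_aut (b0 (+) d0) s.
by exists f; rewrite //= !fE /= addNb addKb s0 s1 s2.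
Qed.

Lemma complete_bipartite_minus_matching_not_3arc_transitive n :
  4 <= n -> ~~ arc_transitive (@complete_bipartite_minus_matching n) 3.
Proof.
case: n => [|[|[|[|n]]]] // _; apply/negP.
pose i0 := Ordinal (isT : 0 < n.+4); pose i1 := Ordinal (isT : 1 < n.+4).
pose i2 := Ordinal (isT : 2 < n.+4); pose i3 := Ordinal (isT : 3 < n.+4).
(* the ends of a 3-arc may be adjacent or matched *)
by move=> /(@arc_transitive_ends _ _ _
    [tuple (false, i0); (true, i1); (false, i2); (true, i0)]
    [tuple (false, i0); (true, i1); (false, i2); (true, i3)]
    (false, i0))/(_ isT isT)[].
Qed.

(** * Complete graphs from triangles, and common neighbours *)

Lemma graph_iso_complete (T : finType) (e : rel T) :
  (forall x y, e x y = (x != y)) -> graph_iso e (@complete_graph #|T|).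
Proof.
move=> eE; exists enum_rank; first exact: enum_rank_bij.
by move=> x y; rewrite eE /complete_graph (inj_eq enum_rank_inj).
Qed.

(** If one 2-arc closes up into a triangle then all do, so that the closed
neighbourhood of a vertex is a connected component. *)
Lemma triangle_2arc_transitive_complete (T : finType) (e : rel T) x y z :
  symmetric e -> irreflexive e -> connected_graph e -> arc_transitive e 2 ->
  e x y -> e y z -> e x z -> forall u v, e u v = (u != v).
Proof.
move=> syme irre conn tr2 exy eyz exz u v.
have [<-|neuv] := eqVneq; first exact: irre.
have nexz : x != z by apply: contraTneq exz => ->; rewrite irre.
have close a b c : e a b -> e b c -> a != c -> e a c.
  move=> eab ebc neac; have := @arc_transitive_ends _ _ _
    [tuple x; y; z] [tuple a; b; c] x tr2.
  by rewrite /= exy eyz eab ebc nexz neac exz => /(_ isT isT)[<-].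
have clos : closed e [pred w | (w == u) || e u w].
  apply: intro_closed => [|a b eab]; first exact: sym_connect_sym.
  rewrite !inE => /orP[/eqP <-|eua]; first by rewrite eab orbT.
  by have [//|neub] := eqVneq b u; apply: close eua eab _; rewrite eq_sym.
have := closed_connect clos (conn u v).
by rewrite !inE eqxx eq_sym (negPf neuv) /= => <-.
Qed.

Definition common_neighbours (T : finType) (e : rel T) x y :=
  [set z | e x z && e z y].

Lemma card_common_neighbours_aut (T : finType) (e : rel T) (f : {perm T}) x y :
  f \in graph_aut e ->
  #|common_neighbours e (f x) (f y)| = #|common_neighbours e x y|.
Proof.
move=> /graph_autP fe; rewrite -[RHS](card_imset _ (@perm_inj _ f)); apply: eq_card => z.
apply/idP/imsetP => [|[w + ->]]; rewrite !inE ?fe //.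
by rewrite -{1 2}(permKV f z) !fe => ez; exists (f^-1%g z); rewrite ?inE ?permKV.
Qed.

(** A common neighbour of x and y is the middle of a 2-arc from x to y, and
some automorphism takes this 2-arc to one from x to z. *)
Lemma card_common_neighbours_2arc_transitive (T : finType) (e : rel T) x y z u v :
  arc_transitive e 2 -> x != y -> u \in common_neighbours e x y ->
  x != z -> v \in common_neighbours e x z ->
  #|common_neighbours e x y| = #|common_neighbours e x z|.
Proof.
move=> /arc_transitiveP[_ _ tra] nexy; rewrite inE => /andP[exu euy].
move=> nexz; rewrite inE => /andP[exv evz].
have := tra [tuple x; u; y] [tuple x; v; z].
rewrite !mem_sarcs /= exu euy exv evz nexy nexz => /(_ isT isT)[f fe [xE vE zE]].
by rewrite -(card_common_neighbours_aut x y fe) -xE -zE.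
Qed.

(** * Cayley graphs and subgroups of index two *)

Section CayleyGraphs.

Local Open Scope group_scope.

Lemma cay_sym (gT : finGroupType) (S : {set gT}) : S^-1 = S -> symmetric (cay S).
Proof. by move=> SV x y; rewrite /cay -[in RHS]SV mem_invg invMg invgK. Qed.

Lemma cay_irr (gT : finGroupType) (S : {set gT}) : 1 \notin S -> irreflexive (cay S).
Proof. by move=> /negPf S1 x; rewrite /cay mulgV. Qed.

(** The connected component of the identity lies in the subgroup generated
by S. *)
Lemma connected_cay_subgroup (gT : finGroupType) (S : {set gT}) (H : {group gT}) x :
  connected_graph (cay S) -> S \subset H -> x \in H.
Proof.
move=> conn /subsetP sSH; have clos : closed (cay S) (mem H).
  by move=> y z /sSH Hyz; rewrite -(mulgKV y z) [RHS]groupMl.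
by have := closed_connect clos (conn 1 x); rewrite group1 => <-.
Qed.

Lemma connected_cay_extend (gT : finGroupType) (S : {set gT}) :
  2 < #|gT| -> S^-1 = S -> connected_graph (cay S) ->
  forall x y, exists2 z, cay S y z & x != z.
Proof.
move=> gt2 SV conn x y.
have [/exists_inP[s Ss sx]|] := boolP [exists s in S, x != s * y].
  by exists (s * y); rewrite // /cay mulgK.
(* otherwise S has at most one element, which is then an involution *)
rewrite negb_exists_in => /forall_inP Sx; set t := x * y^-1.
have St s : s \in S -> s = t by move=> /Sx/negPn/eqP xE; rewrite /t xE mulgK.
have sub : S \subset <[t]> by apply/subsetP=> s Ss; rewrite (St s Ss) cycle_id.
have ordt : #[t] <= 2 \/ S = set0.
  have [-> | [s Ss]] := set_0Vmem S; [by right | left].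
  have : s^-1 = t by apply: St; rewrite -SV mem_invg invgK.
  move=> /(congr1 (fun w => s * w)); rewrite mulgV (St s Ss) => tt.
  by rewrite dvdn_leq // order_dvdn expgS expg1 -tt.
case: ordt => [ord2 | S0].
  have full u : u \in <[t]> := connected_cay_subgroup u conn sub.
  suff : #|gT| <= 2 by rewrite leqNgt gt2.
  by apply: leq_trans ord2; apply/subset_leq_card/subsetP=> u _.
suff : #|gT| <= 1 by rewrite leqNgt (ltnW gt2).
rewrite -(cards1 (1 : gT)); apply/subset_leq_card/subsetP=> u _.
by apply: (@connected_cay_subgroup _ S 1%G) => //; rewrite S0 sub0set.
Qed.

Lemma index2_mem_div (gT : finGroupType) (K : {group gT}) x y :
  #|gT| = (2 * #|K|)%N -> (y * x^-1 \in K) = ((x \in K) == (y \in K)).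
Proof.
move=> cardG; have [Kx|nKx] := boolP (x \in K); first by rewrite groupMr ?groupV.
have [Ky|nKy] := boolP (y \in K); first by rewrite groupMl ?groupV // (negPf nKx).
suff KxE : K :* x = ~: K by rewrite -mem_rcoset KxE inE nKy.
apply/eqP; rewrite eqEcard card_rcoset cardsCs setCK cardG mul2n -addnn addnK leqnn.
rewrite andbT; apply/subsetP=> z; rewrite mem_rcoset inE => Kzx.
by apply: contra nKx => Kz; rewrite -groupV -(groupMl _ Kz).
Qed.

(** Translation by z identifies K with its other coset, and thereby matches
the two parts. *)
Lemma index2_bijection (gT : finGroupType) (K : {group gT}) z :
  #|gT| = (2 * #|K|)%N -> z \notin K ->
  exists f : gT -> bool * 'I_#|K|,
    [/\ bijective f, forall x, (f x).1 = (x \notin K)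
      & forall x y, x \in K -> y \notin K -> ((f x).2 == (f y).2) = (y * x^-1 == z)].
Proof.
move=> cardG nKz; pose h x := if x \in K then x else z^-1 * x.
have Kh x : h x \in K.
  rewrite /h; case: ifPn => // nKx; rewrite -[x]invgK index2_mem_div // !groupV.
  by rewrite (negPf nKx) (negPf nKz).
pose f x := (x \notin K, enum_rank_in (group1 K) (h x)).
have rankE x y : (enum_rank_in (group1 K) (h x) == enum_rank_in (group1 K) (h y)) =
    (h x == h y).
  by apply/eqP/eqP => [|->//]; apply: (can_in_inj (enum_rankK_in (group1 K))).
exists f; split=> // [|x y Kx nKy].
  apply: inj_card_bij; last by rewrite card_prod card_bool card_ord -cardG.
  move=> x y [/negb_inj Kxy /eqP]; rewrite rankE /h Kxy.
  by case: ifP => _ /eqP // /mulgI.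
rewrite /= rankE /h Kx (negPf nKy); apply/eqP/eqP => [->|<-].
  by rewrite invMg invgK mulKVg.
by rewrite invMg invgK mulgKV.
Qed.

Lemma cay_index2_complement (gT : finGroupType) (K : {group gT}) z :
  #|gT| = (2 * #|K|)%N -> z \notin K ->
  graph_iso (cay (~: K)) (@complete_bipartite #|K|).
Proof.
move=> cardG nKz; have [f [bijf f1 _]] := index2_bijection cardG nKz.
exists f => // x y; rewrite /complete_bipartite !f1 /cay inE index2_mem_div //.
by case: (x \in K) (y \in K) => [] [].
Qed.

Lemma cay_index2_complementD1 (gT : finGroupType) (K : {group gT}) z :
  #|gT| = (2 * #|K|)%N -> z \notin K -> (~: K :\ z)^-1 = ~: K :\ z ->
  graph_iso (cay (~: K :\ z)) (@complete_bipartite_minus_matching #|K|).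
Proof.
move=> cardG nKz SV; have [f [bijf f1 f2]] := index2_bijection cardG nKz.
exists f => // x y; rewrite /complete_bipartite_minus_matching !f1.
have adjE u v : u \in K -> v \notin K ->
    cay (~: K :\ z) u v = ((f u).2 != (f v).2).
  move=> Ku nKv; rewrite f2 // /cay !inE index2_mem_div // Ku (negPf nKv).
  by rewrite andbT.
have [Kx|nKx] := boolP (x \in K); have [Ky|nKy] := boolP (y \in K) => /=.
- by rewrite /cay !inE index2_mem_div // Kx Ky andbF.
- by rewrite adjE.
- by rewrite eq_sym (cay_sym SV) adjE.
by rewrite /cay !inE index2_mem_div // (negPf nKx) (negPf nKy) andbF.
Qed.

(** Count the pairs of elements of S by their product: a walk of length two from
the identity ends in K, and is counted once by its middle and last vertex. *)
Lemma card_index2_constant_common_neighbours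
    (gT : finGroupType) (K : {group gT}) (S : {set gT}) mu :
  #|gT| = (2 * #|K|)%N -> S \subset ~: K -> S^-1 = S ->
  (forall g, g \in K -> g != 1 -> #|common_neighbours (cay S) 1 g| = mu) ->
  (#|S| * #|S| = #|S| + #|K|.-1 * mu)%N.
Proof.
move=> cardG /subsetP sSK SV muE.
have mul2 s t : s \in S -> t \in S -> t * s \in K.
  move=> /sSK + /sSK; rewrite !inE -[s in t * s]invgK index2_mem_div // groupV.
  by move=> /negPf-> /negPf->.
have comE g : #|common_neighbours (cay S) 1 g| = (\sum_(s in S) ((g * s^-1)%g \in S))%N.
  rewrite -sum1_card big_mkcond [RHS]big_mkcond; apply: eq_bigr => s _.
  by rewrite inE /cay invg1 mulg1; case: (s \in S) (_ \in S) => [] [].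
have : (\sum_(g in K) #|common_neighbours (cay S) 1%g g| = #|S| * #|S|)%N.
  rewrite (eq_bigr _ (fun g _ => comE g)) exchange_big -sum_nat_const.
  apply: eq_bigr => s Ss; rewrite -(card_rcoset S s) -sum1_card big_mkcond.
  rewrite [RHS]big_mkcond; apply: eq_bigr => g _; rewrite mem_rcoset.
  case: ifP => [_|nKg]; first by case: (_ \in S).
  by case: ifP => // /(mul2 _ _ Ss); rewrite mulgKV nKg.
move=> <-; rewrite (bigD1 1) //=; congr addn.
  rewrite comE -sum1_card; apply: eq_bigr => s Ss; rewrite mul1g.
  by rewrite -[in _ \in S]SV mem_invg invgK Ss.
rewrite (eq_bigr (fun _ => mu)) => [|g /andP[Kg g1]]; last exact: muE.
rewrite sum_nat_const (cardsD1 1 K) group1; congr muln.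
by apply: eq_card => g; rewrite !inE andbC.
Qed.

(** * Dihedral groups *)

Lemma dihedral_rotation n (gT : finGroupType) :
  1 < n -> [set: gT] \isog 'D_(2 * n) ->
  exists x : gT, [/\ #|gT| = (2 * n)%N, #|<[x]>| = n
    & forall u, u \notin <[x]> -> u * u = 1 /\ x ^ u = x^-1].
Proof.
move=> gt1 isoG.
have cardG : #|gT| = (2 * n)%N.
  by rewrite -cardsT (card_isog isoG) mul2n card_dihedral.
have := Grp_dihedral gt1 [set: gT]%G; rewrite -mul2n isog_hom //.
move=> /esym/existsP[[x y]] /=; rewrite !xpair_eqE /=.
move=> /and4P[/eqP genG /eqP xn /eqP y2 /eqP xy].
have nyx : <[y]> \subset 'N(<[x]>).
  by rewrite cycle_subG inE -cycleJ xy cycleV.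
have GE : <[x]> * <[y]> = [set: gT] by rewrite -norm_joinEr.
have lex : #[x] <= n by rewrite dvdn_leq ?order_dvdn ?xn // ltnW.
have ley : #[y] <= 2 by rewrite dvdn_leq // order_dvdn y2.
exists x; split=> //.
  apply/eqP; rewrite eqn_leq lex /=; have := mul_cardG <[x]> <[y]>.
  rewrite GE cardsT cardG -!orderE => cE; rewrite -(@leq_pmul2l 2) //.
  apply: leq_trans (_ : #[x] * #[y] <= _)%N; first by rewrite cE leq_pmulr ?cardG_gt0.
  by rewrite mulnC leq_mul2r ley orbT.
move=> u nxu; have : u \in <[x]> * <[y]> by rewrite GE inE.
move=> /mulsgP[_ _ /cycleP[i ->] /cycleP[j ->] uE].
have {}uE : u = x ^+ i * y.
  move: uE; rewrite -(odd_double_half j) expgD -mul2n expgM y2 expg1n mulg1.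
  by case: (odd j) => // uE; rewrite uE mulg1 mem_cycle in nxu.
have yV : y^-1 = y by apply/eqP; rewrite eq_invg_mul -expg2 y2.
split; last by rewrite uE conjgM (conjgE x) (commuteX i (commute_refl x)) mulKg xy.
rewrite uE; have := conjXg x y i; rewrite conjgE yV xy expgVn => yxy.
by rewrite -mulgA yxy mulgV.
Qed.

(** The rotation subgroup has index at most two over its subgroup of squares,
and conjugating a reflection by rotations moves it by the squares. So a normal
subset that misses a reflection contains exactly half of the reflections or
none. *)
Lemma triangle_free_2arc_transitive_dihedral (gT : finGroupType) (x : gT) (S : {set gT}) :
  #|gT| = (2 * #|<[x]>|)%N ->
  (forall u, u \notin <[x]> -> u * u = 1 /\ x ^ u = x^-1) ->
  S^-1 = S -> (forall s g, s \in S -> s ^ g \in S) ->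
  (forall s t, s \in S -> t \in S -> t * s \notin S) ->
  connected_graph (cay S) -> arc_transitive (cay S) 2 ->
  exists2 K : {group gT}, #|gT| = (2 * #|K|)%N
    & exists2 z, z \notin K & S = ~: K \/ (S = ~: K :\ z /\ ~~ odd #|K|).
Proof.
set A := <[x]>%G; move=> cardG refl SV SJ tf conn tr2.
have divA := index2_mem_div _ _ cardG.
have uV u : u \notin A -> u^-1 = u.
  by case/refl=> uu _; apply/eqP; rewrite eq_invg_mul uu.
have conjA g u : g \in A -> u \notin A -> g ^ u = g^-1.
  by move=> /cycleP[i ->] /refl[_ xu]; rewrite conjXg xu expgVn.
have Smul s t : s \in S -> t \in S -> t * s \in S = false.
  by move=> Ss St; apply/negbTE/tf.
have [b Sb nAb] : exists2 b, b \in S & b \notin A.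
  apply/subsetPn/negP=> sSA; have : #|gT| <= #|A|.
    apply/subset_leq_card/subsetP=> u _; exact: connected_cay_subgroup conn sSA.
  by rewrite leqNgt cardG ltn_Pmull.
have [sAS|] := boolP (~: A \subset S).
  exists A => //; exists b => //; left; apply/eqP; rewrite eq_sym eqEsubset sAS.
  apply/subsetP=> s Ss; rewrite inE; apply/negP=> As.
  have : s * b \in S by apply: (subsetP sAS); rewrite inE groupMl.
  by rewrite Smul.
case/subsetPn=> c; rewrite inE => nAc nSc.
pose Q := <[x ^+ 2]>%G.
have sQA : {subset Q <= A} by apply/subsetP; rewrite cycle_subG mem_cycle.
have SQ q u : q \in Q -> u \notin A -> (q * u \in S) = (u \in S).
  have imp r v : r \in Q -> v \notin A -> v \in S -> r * v \in S.
    move=> /cycleP[i ->] nAv /(SJ _ (x ^+ i)^-1); congr (_ \in S).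
    rewrite conjgE invgK -(conjA _ v (mem_cycle x i) nAv) -conjgC mulgA.
    by rewrite -expgD addnn -mul2n expgM.
  move=> Qq nAu; apply/idP/idP; last exact: imp.
  move=> Squ; rewrite -(mulKg q u); apply: imp Squ; rewrite ?groupV //.
  by rewrite (groupMl _ (sQA q Qq)).
(* rotations that are not squares are odd powers of x *)
have oddA g : g \in A -> g \notin Q -> g * x^-1 \in Q.
  move=> /cycleP[i ->]; rewrite -(odd_double_half i) expgD -mul2n expgM.
  case: (odd i) => /=; last by rewrite mul1g mem_cycle.
  by rewrite expg1 (commuteX _ (commuteX 2 (commute_refl x))) mulgK mem_cycle.
have grp u : u \notin A -> group_set (Q :|: Q :* u).
  move=> nAu; have QJ q : q \in Q -> u * q = q^-1 * u.
    move=> Qq; have := conjA q u (sQA q Qq) nAu.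
    by rewrite conjgE (uV u nAu) => <-; rewrite -!mulgA (proj1 (refl u nAu)) mulg1.
  apply/group_setP; split=> [|v w]; first by rewrite inE group1.
  rewrite !inE (mem_rcoset Q u (v * w)).
  move=> /orP[Qv|/rcosetP[q Qq ->]] /orP[Qw|]; rewrite ?mem_rcoset.
  - by rewrite groupM.
  - by move=> Qwu; apply/orP; right; rewrite -mulgA groupM.
  - by apply/orP; right; rewrite -(mulgA q u w) QJ // mulgA mulgK groupM ?groupV.
  move=> Qwu; apply/orP; left; rewrite -(mulgKV u w) -mulgA [u * (_ * _)]mulgA QJ //.
  by rewrite -(mulgA _ u u) (proj1 (refl u nAu)) mulg1 groupM ?groupV.
pose K := Group (grp c nAc).
have reflE u : u \notin A -> (u \in Q :* b) = (u \in S) /\ (u \in Q :* c) = (u \notin S).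
  move=> nAu; rewrite !mem_rcoset.
  have SQm v : v \notin A -> u * v^-1 \in Q -> (u \in S) = (v \in S).
    by move=> nAv Quv; rewrite -(SQ _ v Quv nAv) mulgKV.
  have div v w : v \notin A -> w \notin A -> v * w^-1 \in A.
    by move=> nAv nAw; rewrite divA (negPf nAv) (negPf nAw).
  have [Qub|nQub] := boolP (u * b^-1 \in Q).
    rewrite (SQm b) // Sb; split=> //; apply/negbTE/negP=> Quc.
    by move: nSc; rewrite -(SQm c) // (SQm b) // Sb.
  have nQcb : c * b^-1 \notin Q.
    by apply/negP=> Qcb; move: nSc; rewrite -(mulgKV b c) SQ // Sb.
  have Quc : u * c^-1 \in Q.
    have := groupM (oddA _ (div _ _ nAu nAb) nQub)
                   (groupVr (oddA _ (div _ _ nAc nAb) nQcb)).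
    by rewrite !invMg !invgK !mulgA !mulgKV.
  by rewrite Quc (SQm c) // (negPf nSc).
have memK u : (u \in K) = (u \in Q) || (u \notin A) && (u \notin S).
  rewrite inE; congr orb; have [Au|nAu] := boolP (u \in A); last by case: (reflE u nAu).
  by rewrite mem_rcoset; apply/negP=> /sQA; rewrite divA Au (negPf nAc).
have SK s : s \in S -> s \notin K.
  move=> Ss; rewrite memK Ss andbF orbF; apply/negP=> Qs.
  by have := Smul b s Sb Ss; rewrite SQ // Sb.
have outside u : u \notin A -> u \notin K -> u \in S.
  by move=> nAu; rewrite memK negb_or nAu /= negbK => /andP[].
have nQr v : v \notin A -> [disjoint Q & Q :* v].
  move=> nAv; rewrite disjoint_subset; apply/subsetP=> q Qq; rewrite inE mem_rcoset.
  by apply/negP=> /sQA; rewrite divA (negPf nAv) (sQA _ Qq).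
have cardK : #|K| = (2 * #|Q|)%N.
  by rewrite /= cardsU disjoint_setI0 ?nQr // cards0 subn0 card_rcoset mul2n addnn.
have cardA : #|A| = (2 * #|Q|)%N.
  have nQx : x \notin Q.
    apply/negP=> Qx; have : c * b^-1 \in Q.
      have : c * b^-1 \in A by rewrite divA (negPf nAb) (negPf nAc).
      by apply/subsetP; rewrite cycle_subG.
    by rewrite -mem_rcoset => Qcb; have [] := reflE c nAc; rewrite Qcb (negPf nSc).
  have -> : (A : {set gT}) = Q :|: Q :* x.
    apply/setP=> g; rewrite inE mem_rcoset; apply/idP/orP=> [Ag|[/sQA //|/sQA]].
      by have [Qg|nQg] := boolP (g \in Q); [left | right; apply: oddA].
    by rewrite groupMr // groupV cycle_id.
  rewrite cardsU card_rcoset mul2n -addnn.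
  suff -> : Q :&: Q :* x = set0 by rewrite cards0 subn0.
  apply/setP=> g; rewrite !inE mem_rcoset; apply/andP=> -[Qg].
  by rewrite groupMl // groupV (negPf nQx).
have cardGK : #|gT| = (2 * #|K|)%N by rewrite cardG cardA cardK.
have divK := index2_mem_div _ _ cardGK.
have Kc : c \in K by rewrite memK nAc nSc orbT.
set r := #|S :&: A|.
have cardS : #|S| = (#|Q| + r)%N.
  rewrite -(cardsID A S) addnC; congr addn; rewrite -(card_rcoset Q b).
  apply: eq_card => u; rewrite inE; have [Au|nAu] := boolP (u \in A).
    by rewrite mem_rcoset; apply/esym/negP=> /sQA; rewrite divA Au (negPf nAb).
  by case: (reflE u nAu).
(* if S contained no rotation, it would lie in the subgroup Q u Q b *)
have [a] : exists a, a \in S :&: A.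
  apply/set0Pn/negP=> /eqP SA0; have sSb : S \subset Group (grp b nAb).
    apply/subsetP=> s Ss; rewrite inE; have nAs : s \notin A.
      by apply/negP=> As; have := in_set0 s; rewrite -SA0 inE Ss As.
    by rewrite (proj1 (reflE s nAs)) Ss orbT.
  have := connected_cay_subgroup c conn sSb; rewrite inE.
  by rewrite (proj1 (reflE c nAc)) (negPf nSc) orbF => /sQA; rewrite (negPf nAc).
case/setIP=> Sa Aa.
have comE g z : (z \in common_neighbours (cay S) 1 g) = (z \in S) && (g * z^-1 \in S).
  by rewrite inE /cay invg1 mulg1.
have n1c : 1 != c by apply: contraNneq (nAc) => <-; apply: group1.
(* one of the two factors of the reflection c is a rotation, which may be any
   rotation in S; it determines the other factor *)
have comc : #|common_neighbours (cay S) 1 c| = (2 * r)%N.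
  rewrite -(cardsID A) mul2n -addnn; congr addn.
    apply: eq_card => z; rewrite !in_setI comE.
    have [Az|] := boolP (z \in A); rewrite ?andbF // !andbT.
    have [Sz|//] := boolP (z \in S).
    apply: outside; first by rewrite divA Az (negPf nAc).
    by rewrite divK Kc (negPf (SK _ Sz)).
  rewrite /r -(card_imset (S :&: A) (f := fun t => t^-1 * c)); last first.
    by move=> t t' /mulIg/invg_inj.
  apply: eq_card => z; rewrite in_setD comE; apply/and3P/imsetP.
    move=> [nAz Sz Scz]; exists (c * z^-1); last by rewrite invMg invgK mulgKV.
    by rewrite inE Scz divA (negPf nAz) (negPf nAc).
  move=> [t /setIP[St At] ->]; rewrite invMg invgK mulKVg groupMl ?groupV //.
  split=> //; apply: outside; first by rewrite groupMl ?groupV.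
  by rewrite groupMr ?groupV ?SK.
have comK g : g \in K -> g != 1 -> #|common_neighbours (cay S) 1 g| = (2 * r)%N.
  move=> Kg g1; rewrite -comc.
  have comca : a \in common_neighbours (cay S) 1 c.
    rewrite comE Sa outside //; first by rewrite divA Aa (negPf nAc).
    by rewrite divK Kc (negPf (SK _ Sa)).
  have [w comw] : exists w, w \in common_neighbours (cay S) 1 g.
    move: (Kg); rewrite memK => /orP[Qg|/andP[nAg nSg]].
      by exists b; rewrite comE Sb (uV b nAb) SQ.
    exists a; rewrite comE Sa outside //; first by rewrite divA Aa (negPf nAg).
    by rewrite divK Kg (negPf (SK _ Sa)).
  by apply: (card_common_neighbours_2arc_transitive tr2 _ comw n1c comca); rewrite eq_sym.
have sSK : S \subset ~: K by apply/subsetP=> s /SK; rewrite in_setC.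
have := card_index2_constant_common_neighbours cardGK sSK SV comK.
have cardCK : #|~: K| = (2 * #|Q|)%N.
  by rewrite cardsCs setCK cardGK cardK mul2n -addnn addnK.
have := subset_leq_card sSK; rewrite cardCK cardK cardS => leS count.
have Q0 : 0 < #|Q| by apply: cardG_gt0.
(* the counts give (#|Q| - r) ^ 2 = #|Q| - r *)
have [rE|rE] : r = #|Q| \/ #|Q| = r.+1 by nia.
  exists K => //; exists b; rewrite ?SK //; left.
  by apply/eqP; rewrite eqEcard sSK cardCK cardS rE mul2n addnn leqnn.
have /eqP/cards1P[z zE] : #|~: K :\: S| = 1%N.
  by rewrite cardsD (setIidPr sSK) cardCK cardS rE; lia.
have : z \in ~: K :\: S by rewrite zE set11.
rewrite in_setD in_setC => /andP[nSz nKz]; exists K => //; exists z; first by [].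
right.
split; last by rewrite cardK mul2n odd_double.
by rewrite -zE setDDr setDv set0U; apply/esym/setIidPr.
Qed.

End CayleyGraphs.

(** * The classification *)

Theorem corollary1p2 (n : nat) (gT : finGroupType) (S : {set gT}) :
  3 <= n ->
  [set: gT]%g \isog ('D_(2 * n))%g ->
  1%g \notin S ->
  (S^-1)%g = S ->
  union_of_classes S ->
  connected_graph (cay S) ->
  [/\ forall s : nat, 4 <= s -> ~~ arc_transitive (cay S) s,
      arc_transitive (cay S) 3 <->
        graph_iso (cay S) (@complete_bipartite n)
    & arc_transitive (cay S) 2 <->
        [\/ graph_iso (cay S) (@complete_graph (2 * n)),
            graph_iso (cay S) (@complete_bipartite n)
          | 4 <= n /\
            graph_iso (cay S) (@complete_bipartite_minus_matching n)]].
Proof.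
move=> ge3 isoG S1 SV [C /subsetP sC SC] conn.
have SJ s g : s \in S -> (s ^ g)%g \in S.
  rewrite SC => /bigcupP[B CB Bs]; apply/bigcupP; exists B => //.
  have /imsetP[t _ BE] := sC _ CB; move: Bs; rewrite BE => /imsetP[h _ ->].
  by rewrite -conjgM memJ_class ?inE.
have [x [cardG cardA refl]] := dihedral_rotation (ltnW ge3) isoG.
have gt2 : 2 < #|gT| by rewrite cardG; lia.
have drop s : arc_transitive (cay S) s.+1 -> arc_transitive (cay S) s.
  exact/arc_transitive_pred/connected_cay_extend.
have classify : arc_transitive (cay S) 2 ->
    [\/ graph_iso (cay S) (@complete_graph (2 * n)),
        graph_iso (cay S) (@complete_bipartite n)
      | 4 <= n /\ graph_iso (cay S) (@complete_bipartite_minus_matching n)].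
  move=> tr2; have [/exists_inP[s Ss /exists_inP[t St Sts]] | tf] :=
    boolP [exists s in S, exists t in S, (t * s)%g \in S].
    constructor 1; rewrite -cardG; apply: graph_iso_complete.
    apply: (@triangle_2arc_transitive_complete _ _ 1%g s (t * s)%g) => //.
    - exact: cay_sym.
    - exact: cay_irr.
    - by rewrite /cay invg1 mulg1.
    - by rewrite /cay mulgK.
    - by rewrite /cay invg1 mulg1.
  have {}tf s t : s \in S -> t \in S -> (t * s)%g \notin S.
    move=> Ss St; apply: contra tf => Sts; apply/exists_inP; exists s => //.
    by apply/exists_inP; exists t.
  rewrite -cardA in cardG.
  have [K cardGK [z nKz]] :=
    triangle_free_2arc_transitive_dihedral cardG refl SV SJ tf conn tr2.
  have cardK : #|K| = n by move: cardGK; rewrite cardG cardA; lia.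
  case=> [SE | [SE oddK]].
    by constructor 2; rewrite SE -cardK; apply: cay_index2_complement nKz.
  constructor 3; rewrite -cardK in ge3 *; split; last first.
    by rewrite SE; apply: cay_index2_complementD1; rewrite -?SE.
  by case: #|K| ge3 oddK => [|[|[|[|m]]]].
have iff3 : arc_transitive (cay S) 3 <-> graph_iso (cay S) (@complete_bipartite n).
  split=> [tr3 | iso]; last first.
    apply: arc_transitive_iso (graph_iso_sym iso) _.
    exact/complete_bipartite_3arc_transitive/ltnW.
  case: (classify (drop _ tr3)) => // [iso | [ge4 iso]].
    have := arc_transitive_iso iso tr3.
    by rewrite (negPf (complete_graph_not_3arc_transitive _)) //; lia.
  have := arc_transitive_iso iso tr3.
  by rewrite (negPf (complete_bipartite_minus_matching_not_3arc_transitive _)).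
split=> // [s ge4 | ].
  apply/negP=> trs; have {trs} tr4 : arc_transitive (cay S) 4.
    elim: s ge4 trs => // s IHs; rewrite leq_eqVlt => /predU1P[<- //|ge4 /drop].
    exact: IHs.
  have := arc_transitive_iso (proj1 iff3 (drop _ tr4)) tr4.
  by rewrite (negPf (complete_bipartite_not_4arc_transitive _)).
split=> // -[iso | iso | [ge4 iso]].
- apply: arc_transitive_iso (graph_iso_sym iso) _.
  by apply: complete_graph_2arc_transitive; lia.
- exact/drop/(proj2 iff3).
apply: arc_transitive_iso (graph_iso_sym iso) _.
exact/complete_bipartite_minus_matching_2arc_transitive/ltnW.
Qed.
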